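(* Let $G$ be a connected amply regular graph (simple, locally finite, possibly infinite) with parameters $(d,\alpha,\beta)$ with $\beta>1$. Then $G$ is $d$-edge-connected. Further, if $G$ is not a quadrangle, then the only disconnecting sets of $d$ edges are the sets of $d$ edges on a single vertex; that is, if $F\subset E(G)$ has exactly $d$ elements and $G-F$ is disconnected, then $F$ is the set of all $d$ edges incident with some vertex of $G$.
   Context: All graphs are simple and locally finite (every vertex has finite degree), possibly infinite. A $d$-regular graph $G$ which is neither complete nor empty (i.e. not edgeless) is called amply regular with parameters $(d,\alpha,\beta)$ if any two adjacent vertices have exactly $\alpha$ common neighbors, and any two vertices at distance two have exactly $\beta$ common neighbors. A graph $G=(V,E)$ with at least two vertices is called $l$-edge-connected if $G-F$ is connected for every set $F\subset E$ of fewer than $l$ edges, where $G-F$ is obtained from $G$ by deleting the edges in $F$ and keeping all vertices. A set $F\subset E$ in a connected graph $G$ is disconnecting if $G-F$ is disconnected. A quadrangle is a cycle of length $4$. *)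

(* Defs.v *)
From mathcomp Require Import all_boot.
From mathcomp Require Import boolp classical_sets functions cardinality.

Set Implicit Arguments.
Unset Strict Implicit.
Unset Printing Implicit Defensive.

Local Open Scope classical_set_scope.
Local Open Scope card_scope.

(* Simple graphs on an arbitrary, possibly infinite, vertex type. *)
Record sgraph := SGraph {
  vertex :> Type;
  adj : rel vertex;
  adj_sym : symmetric adj;
  adj_irr : irreflexive adj
}.

Arguments adj {s}.

Section Graph.
Variable G : sgraph.
Implicit Types (x y v : G) (F : set (set G)) (d l alpha beta : nat).

Definition nbhd x : set G := [set y | adj x y].

Definition common_nbrs x y : set G := nbhd x `&` nbhd y.

Definition locally_finite := forall x, finite_set (nbhd x).

Definition regular d := forall x, nbhd x #= `I_d.

Definition complete_graph := forall x y, x <> y -> adj x y.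

Definition edgeless := forall x y, ~~ adj x y.

(* The sequence p omits the starting vertex x, so the length is size p. *)
Definition walk x y (p : seq G) := path adj x p /\ last x p = y.

Definition at_distance (n : nat) x y :=
  (exists2 p, walk x y p & size p = n) /\
  (forall p, walk x y p -> n <= size p).

Definition connected_graph :=
  (exists x : G, True) /\ forall x y, exists p, walk x y p.

Definition amply_regular d alpha beta :=
  [/\ regular d,
      ~ complete_graph,
      ~ edgeless,
      forall x y, adj x y -> common_nbrs x y #= `I_alpha &
      forall x y, at_distance 2 x y -> common_nbrs x y #= `I_beta].

(* An edge is the unordered pair of its ends. *)
Definition edges : set (set G) :=
  [set e | exists x y, adj x y /\ e = [set x; y]].

Definition edges_at v : set (set G) := [set e | edges e /\ e v].

Definition del_adj F : rel G :=
  fun x y => adj x y && ~~ `[< F [set x; y] >].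

Lemma del_adj_sym F : symmetric (del_adj F).
Proof. by move=> x y; rewrite /del_adj adj_sym setUC. Qed.

Lemma del_adj_irr F : irreflexive (del_adj F).
Proof. by move=> x; rewrite /del_adj adj_irr. Qed.

Definition del_edges F : sgraph := SGraph (@del_adj_sym F) (@del_adj_irr F).

End Graph.

Arguments edges : clear implicits.
Arguments connected_graph : clear implicits.
Arguments amply_regular : clear implicits.
Arguments locally_finite : clear implicits.

Definition edge_connected (G : sgraph) (l : nat) :=
  (exists x y : G, x <> y) /\
  forall F : set (set G), F `<=` edges G ->
    (exists2 k, k < l & F #= `I_k) -> connected_graph (del_edges F).

Definition disconnecting (G : sgraph) (F : set (set G)) :=
  F `<=` edges G /\ ~ connected_graph (del_edges F).

Definition isomorphic (G H : sgraph) :=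
  exists2 f : G -> H, bijective f & forall x y, adj (f x) (f y) = adj x y.

(* ordS is the cyclic successor; this is the n-cycle for n >= 3. *)
Definition cycle_adj (n : nat) : rel 'I_n :=
  fun i j => (i != j) && ((j == ordS i) || (i == ordS j)).

Lemma cycle_adj_sym n : symmetric (@cycle_adj n).
Proof. by move=> i j; rewrite /cycle_adj eq_sym orbC. Qed.

Lemma cycle_adj_irr n : irreflexive (@cycle_adj n).
Proof. by move=> i; rewrite /cycle_adj eqxx. Qed.

Definition cycle_graph (n : nat) : sgraph :=
  SGraph (@cycle_adj_sym n) (@cycle_adj_irr n).

Definition quadrangle (G : sgraph) := isomorphic G (cycle_graph 4).

(* Main.v *)
Require Import Defs.
From HB Require Import structures.
From mathcomp Require Import all_boot finmap zify.
From mathcomp Require Import boolp classical_sets functions cardinality.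

Local Open Scope classical_set_scope.
Local Open Scope card_scope.

(** Let [A] be a component of [G - F], so that all edges of [G] leaving [A] lie
    in [F], and let [xy] be one of them, with [x] in [A]. Put [P = N(x) \ y] and
    [Q = N(y) \ x]. Send one unit of flow from [x] to [y] along [xy], one unit
    from [x] to each vertex of [P], one unit from each vertex of [Q] to [y], and
    [1 / (beta - 1)] units from [p] to [q] along each edge with [p] in [P] and
    [q] in [Q] (edges inside [P :&: Q] then carry nothing). A vertex of [P] not
    adjacent to [y] is at distance two from [y], so it has exactly [beta - 1]
    neighbours in [Q]; a common neighbour of [x] and [y] has [alpha - 1]
    neighbours in [P] and as many in [Q]. Hence this is a flow of value [d], no
    edge carries more than one unit, and at least [d] edges leave [A]. The lemma
    [flow_balance] is the resulting identity between counts, and [crosses_ge] is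
    the bound.

    If exactly [d] edges leave [A], then each of them carries one full unit
    outwards, and they make up [F]. So for every other such edge [pq] disjoint
    from [xy], with [p] in [A], necessarily [p] is adjacent to [x], [q] is
    adjacent to [y], [beta = 2], and [xq], [py] are not both edges of [G]
    ([crosses_eq]). If no two edges leaving [A] are disjoint, they form a star,
    so [F] consists of [d] edges at its centre, that is, of all of them.
    Suppose that [xy] and [pq] are disjoint. A diagonal [py] would force every
    edge leaving [A] to meet [p] or [y] and give these two vertices too many
    common neighbours ([disjoint_no_diagonal]). Without diagonals, [xy] and [pq]
    are the only edges leaving [A] at their ends; this gives [alpha = 0], then
    shows that there is no third edge leaving [A], so [d = 2] and [G] is a
    quadrangle ([disjoint_quadrangle]). *)

(** Vertices have no given decidable equality; the classical one is used, which
    makes sequences and finite sets of vertices available. *)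
HB.instance Definition _ (G : sgraph) := gen_eqMixin (vertex G).
HB.instance Definition _ (G : sgraph) := gen_choiceMixin (vertex G).

(** * Counting in a sequence *)

Section Counting.
Context {T : eqType} (s : seq T).

(** The number of pairs of entries of [s] related by [r]. *)
Definition paircount (r : rel T) : nat :=
  \sum_(p <- s) \sum_(q <- s) (r p q : nat).

Lemma sum_count (P : pred T) : \sum_(v <- s) (P v : nat) = count P s.
Proof.
by rewrite -sum1_count [in RHS]big_mkcond; apply: eq_bigr => v _; case: (P v).
Qed.

Lemma countD (P P1 P2 : pred T) :
    (forall v, P v = P1 v + P2 v :> nat) -> count P s = count P1 s + count P2 s.
Proof.
by move=> E; rewrite -!sum_count -big_split; apply: eq_bigr => v _; exact: E.
Qed.

Lemma paircountD (r r1 r2 : rel T) :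
    (forall p q, r p q = r1 p q + r2 p q :> nat) ->
  paircount r = paircount r1 + paircount r2.
Proof.
move=> E; rewrite /paircount -big_split; apply: eq_bigr => p _ /=.
by rewrite -big_split; apply: eq_bigr => q _; exact: E.
Qed.

Lemma eq_paircount (r1 r2 : rel T) : r1 =2 r2 -> paircount r1 = paircount r2.
Proof. by move=> E; apply: eq_bigr => p _; apply: eq_bigr => q _; rewrite E. Qed.

Lemma paircountC (r : rel T) : paircount r = paircount (fun p q => r q p).
Proof. exact: exchange_big. Qed.

Lemma paircount_eq0 (r : rel T) p q :
  paircount r = 0 -> p \in s -> q \in s -> r p q = false.
Proof.
move=> /eqP; rewrite sum_nat_seq_eq0 => /allP rP ps qs.
move: (rP p ps) => /=; rewrite sum_nat_seq_eq0 => /allP /(_ q qs) /=.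
by case: (r p q).
Qed.

Hypothesis s_uniq : uniq s.

Lemma count_remove (P : pred T) x : x \in s -> P x ->
  count P s = (count (fun v => P v && (v != x)) s).+1.
Proof.
move=> xs Px.
rewrite (@countD P (fun v => P v && (v != x)) (pred1 x)) => [|v /=].
  by rewrite count_uniq_mem // xs addn1.
by case: eqP => [->|_]; rewrite ?Px ?andbT ?addn0.
Qed.

Lemma paircount_row x (P : pred T) : x \in s ->
  paircount (fun p q => (p == x) && P q) = count P s.
Proof.
move=> xs; rewrite /paircount (bigD1_seq x) //= eqxx sum_count.
rewrite big1 ?addn0 // => p /negbTE px.
by rewrite big1 // => q _; rewrite px.
Qed.

(** Distinct related pairs that [f] sends to distinct members of a set with
    [k] elements: there are at most [k] of them, and if there are exactly [k]
    then [f] hits every member. *)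
Lemma paircount_inj (U : choiceType) (r : rel T) (f : T -> T -> U)
    (F : set U) (k : nat) :
    F #= `I_k -> (forall p q, r p q -> F (f p q)) ->
    (forall p q p' q', r p q -> r p' q' -> f p q = f p' q' -> (p, q) = (p', q')) ->
  (paircount r <= k) /\
  (k <= paircount r -> forall u, F u -> exists p q, r p q /\ u = f p q).
Proof.
move=> Fk rF f_inj.
have [X F_X] : exists X : {fset U}, F = [set` X].
  by apply/finite_fsetP/finite_setP; exists k.
rewrite {F}F_X in Fk rF *; move/card_eq_fsetP: Fk => Xk.
pose l := [seq pq <- [seq (p, q) | p <- s, q <- s] | r pq.1 pq.2].
have l_size : size l = paircount r.
  rewrite size_filter -sum1_count big_mkcond big_allpairs.
  by apply: eq_bigr => p _; apply: eq_bigr => q _; case: (r p q).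
pose fl := [seq f pq.1 pq.2 | pq <- l].
have fl_uniq : uniq fl.
  rewrite map_inj_in_uniq ?filter_uniq ?allpairs_uniq //.
    by move=> [? ?] [? ?].
  move=> [p q] [p' q']; rewrite !mem_filter /= => /andP[rpq _] /andP[rpq' _].
  exact: f_inj.
have fl_sub : {subset fl <= X}.
  by move=> u /mapP[[p q]]; rewrite mem_filter /= => /andP[/rF ? _] ->.
have := uniq_leq_size fl_uniq fl_sub.
rewrite size_map l_size => fl_le; split; first by rewrite -Xk.
rewrite -Xk => k_le u /= uX.
have [|_ flE] := uniq_min_size fl_uniq fl_sub; first by rewrite size_map l_size.
move: uX; rewrite -flE => /mapP[[p q]]; rewrite mem_filter /= => /andP[rpq _] ->.
by exists p, q.
Qed.

End Counting.

Arguments paircount_eq0 {T s r}.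

(** A set with [k] elements contained in the entries of [l]. *)
Lemma card_sub_seq (U : choiceType) (F : set U) (k : nat) (l : seq U) :
    F #= `I_k -> (forall u, F u -> u \in l) ->
  k <= size l /\ (size l <= k -> forall u, u \in l -> F u).
Proof.
move=> Fk Fl; have [X F_X] : exists X : {fset U}, F = [set` X].
  by apply/finite_fsetP/finite_setP; exists k.
rewrite {F}F_X in Fk Fl *; move/card_eq_fsetP: Fk => <-.
have X_uniq := fset_uniq X; split; first exact: uniq_leq_size.
move=> l_le u ul /=.
by have [_ ->] := uniq_min_size X_uniq Fl l_le.
Qed.

Lemma card_count (T : choiceType) (B : set T) (n : nat) (s : seq T) (P : pred T) :
    uniq s -> B #= `I_n -> (forall v, P v <-> B v) -> (forall v, P v -> v \in s) ->
  count P s = n.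
Proof.
move=> s_uniq Bn BP Ps; have [X B_X] : exists X : {fset T}, B = [set` X].
  by apply/finite_fsetP/finite_setP; exists n.
rewrite {B}B_X in Bn BP *; move/card_eq_fsetP: Bn => <-.
rewrite -size_filter; apply/perm_size/uniq_perm; rewrite ?filter_uniq ?fset_uniq //.
move=> v; rewrite mem_filter; apply/andP/idP => [[/BP//]|/BP Pv]; split=> //.
exact: Ps.
Qed.

(** The arithmetic of the flow. With [b = beta - 1], the numbers [fwd] and [bwd]
    count the edges from [P] to [Q] that leave and enter [A]; [inx] and [outx]
    count the neighbours of [x] inside and outside [A], and [iny] those of [y],
    other than [x], inside [A]; [far] counts the edges leaving [A] that avoid
    [x] and [y], and [rest] those among them that are not counted by [fwd]. *)
Lemma flow_slack (b fwd bwd rest far inx iny outx total d : nat) : 0 < b ->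
    fwd + b * iny = bwd + b * inx -> inx + outx = d -> far = fwd + rest ->
    total = outx + iny + far ->
  d <= total /\ (total <= d -> far <> 0 -> [/\ rest = 0, bwd = 0 & b = 1]).
Proof.
case: b => // b _; rewrite !mulSn => flow degx farE ->; split=> [|le far0].
  have [//|lt] := leqP d (outx + iny + far).
  have : b * iny <= b * inx by rewrite leq_mul2l; lia.
  lia.
have [k inxE] : exists k, inx = iny + far + k by exists (inx - (iny + far)); lia.
rewrite {}inxE !mulnDr in flow degx.
have bfar : b * far = 0 by lia.
split; [lia|lia|].
by move/eqP: bfar; rewrite muln_eq0 => /orP[/eqP->|/eqP/far0].
Qed.

(** * Neighbourhoods in amply regular graphs *)

Section Regularity.
Context {G : sgraph} (d alpha beta : nat).
Hypothesis G_amply : amply_regular G d alpha beta.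
Implicit Types (x y p q v : G) (s : seq G).

(** [s] lists at least all the neighbours of [v]. *)
Definition covers s v := forall w, adj v w -> w \in s.

Lemma count_adj s v : uniq s -> covers s v -> count (adj v) s = d.
Proof.
by move=> s_uniq sv; case: G_amply => reg _ _ _ _; exact: (@card_count _ (nbhd v)).
Qed.

Lemma adj_neq x y : adj x y -> x != y.
Proof. by apply: contraTneq => ->; rewrite adj_irr. Qed.

Lemma at_distance2 x y z : x != y -> ~~ adj x y -> adj x z -> adj z y ->
  at_distance 2 x y.
Proof.
move=> xy nxy xz zy; split; first by exists [:: z; y]; rewrite /walk //= xz zy.
move=> [|w [|w' p]] [] //=; first by move=> _ E; rewrite E eqxx in xy.
by rewrite andbT => xw E; rewrite -E xw in nxy.
Qed.

Lemma count_common_adj s x y : uniq s -> covers s y -> adj x y ->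
  count (fun v => adj x v && adj y v) s = alpha.
Proof.
case: G_amply => _ _ _ adjP _ s_uniq sy xy.
apply: (@card_count _ (common_nbrs x y)) => //; last by move=> v /andP[_ /sy].
- exact: adjP.
- by move=> v; split=> [/andP[]|[]] xv yv; [split|apply/andP].
Qed.

Lemma count_common s x y z : uniq s -> covers s y -> x != y ->
    adj x z -> adj z y ->
  count (fun v => adj x v && adj y v) s = if adj x y then alpha else beta.
Proof.
move=> s_uniq sy xy xz zy; case: ifPn => nxy; first exact: count_common_adj.
case: G_amply => _ _ _ _ distP.
apply: (@card_count _ (common_nbrs x y)) => //; last by move=> v /andP[_ /sy].
- exact: distP (at_distance2 x y z xy nxy xz zy).
- by move=> v; split=> [/andP[]|[]] xv yv; [split|apply/andP].
Qed.

(** Every neighbour [p] of [x] has [alpha - 1] or [beta - 1] neighbours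
    besides [x] in the neighbourhood of an adjacent vertex [y]. *)
Lemma count_opposite s x y p : uniq s -> covers s y -> adj x y ->
    adj x p -> p != y ->
  count (fun q => [&& adj y q, q != x & adj p q]) s =
  (if adj y p then alpha else beta).-1.
Proof.
move=> s_uniq sy xy xp py; rewrite adj_sym in xp.
rewrite (adj_sym y p) -(count_common s p y x s_uniq sy py xp xy).
rewrite [in RHS](@count_remove _ s s_uniq _ x) /=; last by rewrite xp adj_sym xy.
  by apply: eq_count => q /=; case: (adj y q); case: (adj p q); case: (q != x).
by apply: sy; rewrite adj_sym.
Qed.

(** Finitely many vertices and all their neighbours can be listed. *)
Lemma cover_exists (l : seq G) :
  exists s, uniq s /\ forall v, v \in l -> v \in s /\ covers s v.
Proof.
elim: l => [|v l [s [s_uniq sl]]]; first by exists [::].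
have [X vX] : exists X : {fset G}, nbhd v = [set` X].
  by apply/finite_fsetP/finite_setP; exists d; case: G_amply.
exists (undup (v :: X ++ s)); split; first exact: undup_uniq.
have mem w : w \in undup (v :: X ++ s) = [|| w == v, w \in X | w \in s].
  by rewrite mem_undup inE mem_cat.
move=> w; rewrite inE mem => /predU1P[->|/sl[ws sw]].
  rewrite eqxx; split=> // u vu; rewrite mem.
  by have : nbhd v u by []; rewrite vX /= => ->; rewrite orbT.
rewrite ws !orbT; split=> // u /sw us; by rewrite mem us !orbT.
Qed.

(** Pairwise distinct common neighbours of two vertices at distance two. *)
Lemma common_le x y (l : seq G) : uniq l -> x != y -> ~~ adj x y ->
  {in l, forall v, adj x v && adj y v} -> l != [::] -> size l <= beta.
Proof.
move=> l_uniq xy nxy; case El: l => [//|z l'] lP _; rewrite -El in lP *.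
have [s [s_uniq sE]] := cover_exists [:: y].
have [_ sy] := sE y (mem_head _ _).
have /andP[xz yz] : adj x z && adj y z by apply: lP; rewrite El mem_head.
rewrite adj_sym in yz.
have := count_common s x y z s_uniq sy xy xz yz; rewrite (negbTE nxy) => <-.
rewrite -size_filter; apply: uniq_leq_size => // v /lP vP.
by rewrite mem_filter vP; case/andP: vP => _ /sy.
Qed.

(** [d] distinct neighbours of [x] are all of them. *)
Lemma adj_mem x v (l : seq G) : uniq l -> {in l, forall w, adj x w} ->
  d <= size l -> adj x v -> v \in l.
Proof.
move=> l_uniq lP ld xv.
have [s [s_uniq sE]] := cover_exists [:: x].
have [_ sx] := sE x (mem_head _ _).
have sub : {subset l <= filter (adj x) s}.
  by move=> w /lP xw; rewrite mem_filter xw sx.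
have [|_ ->] := uniq_min_size l_uniq sub; last by rewrite mem_filter xv sx.
by rewrite size_filter (count_adj s x).
Qed.

(** * The flow across an edge leaving a vertex set *)

Section Flow.
Context (A : pred G) (s : seq G) (x y : G).
Hypothesis s_uniq : uniq s.
Hypothesis xy : adj x y.

(** Counts by their source in [A] the edges that lead from the neighbours of
    [x] other than [y] to the neighbours of [y] other than [x]. *)
Lemma count_sources : covers s x -> covers s y ->
  paircount s (fun p q => [&& A p, adj x p, p != y, adj y q, q != x & adj p q]) =
  beta.-1 * count (fun p => [&& A p, adj x p, p != y & ~~ adj y p]) s +
  alpha.-1 * count (fun p => [&& A p, adj x p & adj y p]) s.
Proof.
move=> sx sy; rewrite -!sum_count !big_distrr -big_split /=.
apply: eq_bigr => p _.
have [Ap|_] /= := boolP (A p); last by rewrite big1_eq !muln0.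
have [xp|_] /= := boolP (adj x p); last by rewrite big1_eq !muln0.
have [->|py] /= := eqVneq p y; first by rewrite big1_eq adj_irr !muln0.
rewrite sum_count (count_opposite s x y p) //.
by case: (adj y p); rewrite !muln1 !muln0 ?addn0.
Qed.

End Flow.

(** The ordered pair [(p, q)] is an edge that leaves [A]. *)
Definition crosses (A : pred G) : rel G := fun p q => [&& A p, ~~ A q & adj p q].

Section Cut.
Context (A : pred G) (s : seq G) (x y : G).
Hypothesis s_uniq : uniq s.
Hypothesis sx : covers s x.
Hypothesis sy : covers s y.
Hypothesis Axy : crosses A x y.

Let Ax : A x. Proof. by case/and3P: Axy. Qed.
Let nAy : ~~ A y. Proof. by case/and3P: Axy. Qed.
Let xy : adj x y. Proof. by case/and3P: Axy. Qed.
Let xs : x \in s. Proof. by apply: sy; rewrite adj_sym. Qed.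
Let ys : y \in s. Proof. exact: sx. Qed.

(** The edges from [N(x) \ y] to [N(y) \ x]. *)
Definition middle : rel G :=
  fun p q => [&& adj x p, p != y, adj y q, q != x & adj p q].

(** The net amount, in units of [1 / (beta - 1)], that the edges of [middle]
    carry out of [A]: at each vertex of [N(x) \ y] or [N(y) \ x] the flow along
    these edges matches the unit sent from [x] or to [y]. *)
Lemma flow_balance :
  paircount s (fun p q => [&& A p, ~~ A q & middle p q]) +
    beta.-1 * count (fun q => [&& A q, adj y q & q != x]) s =
  paircount s (fun p q => [&& ~~ A p, A q & middle p q]) +
    beta.-1 * count (fun p => A p && adj x p) s.
Proof.
have yx : adj y x by rewrite adj_sym.
have L := count_sources A s x y s_uniq xy sx sy.
have R := count_sources A s y x s_uniq yx sy sx.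
rewrite paircountC in R.
rewrite (@paircountD _ s _ (fun p q => [&& A p, ~~ A q & middle p q])
   (fun p q => [&& A p, A q & middle p q])) in L; last first.
  by move=> p q; rewrite /middle; case: (A p); case: (A q); rewrite ?addn0.
rewrite (@paircountD _ s _ (fun p q => [&& ~~ A p, A q & middle p q])
   (fun p q => [&& A p, A q & middle p q])) in R; last first.
  move=> p q; rewrite /middle /= (adj_sym q p).
  by case: (adj p q); case: (A p); case: (A q); case: (adj x p);
     case: (p != y); case: (adj y q); case: (q != x).
rewrite (@countD _ s _ (fun q => [&& A q, adj y q, q != x & ~~ adj x q])
   (fun q => [&& A q, adj y q & adj x q])); last first.
  move=> q; case: (A q); case: (adj y q) => //=.
  by case: eqVneq => [->|_]; rewrite ?adj_irr //=; case: (adj x q).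
rewrite (@countD _ s (fun p => A p && adj x p)
   (fun p => [&& A p, adj x p, p != y & ~~ adj y p])
   (fun p => [&& A p, adj x p & adj y p])); last first.
  move=> p; case Ap: (A p); case: (adj x p) => //=.
  by case: eqVneq => [E|_]; [rewrite E (negbTE nAy) in Ap|case: (adj y p)].
rewrite !mulnDr.
have C : count (fun q => [&& A q, adj y q & adj x q]) s =
         count (fun q => [&& A q, adj x q & adj y q]) s.
  by apply: eq_count => q; rewrite [adj y q && _]andbC.
rewrite C in R *; move: L R.
move: (_ * count _ s) (_ * count _ s) (_ * count _ s) (_ * count _ s) => a1 a2 a3 a4.
lia.
Qed.

(** The edges that leave [A] and avoid both [x] and [y]. *)
Definition far_cross : rel G := fun p q => [&& crosses A p q, p != x & q != y].

Lemma count_crosses :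
  paircount s (crosses A) =
  count (fun q => adj x q && ~~ A q) s +
  count (fun q => [&& A q, adj y q & q != x]) s + paircount s far_cross.
Proof.
rewrite (@paircountD _ s _ (fun p q => (p == x) && (adj x q && ~~ A q))
   (fun p q => (p != x) && crosses A p q)) => [|p q]; last first.
  rewrite /crosses; case: eqVneq => [->|_]; last by [].
  by rewrite Ax /=; case: (A q); case: (adj x q).
rewrite paircount_row // -addnA; congr addn.
rewrite (@paircountD _ s _ (fun p q => (q == y) && [&& A p, adj y p & p != x])
   far_cross) => [|p q]; last first.
  rewrite /far_cross /crosses; case: (eqVneq q y) => [->|_] /=.
    by rewrite nAy adj_sym /=; case: (A p); case: (adj y p); case: (p != x).
  by case: (A p); case: (A q); case: (adj p q); case: (p != x).
by rewrite [paircount s _]paircountC paircount_row.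
Qed.

Hypothesis beta_gt1 : 1 < beta.

Let degree_split :
  count (fun p => A p && adj x p) s + count (fun q => adj x q && ~~ A q) s = d.
Proof.
have <- : count (adj x) s = d by exact: count_adj.
by symmetry; apply: countD => v; case: (A v); case: (adj x v).
Qed.

Let far_cross_split : paircount s far_cross =
  paircount s (fun p q => [&& A p, ~~ A q & middle p q]) +
  paircount s (fun p q => far_cross p q && ~~ (adj x p && adj y q)).
Proof.
apply: paircountD => p q; rewrite /far_cross /crosses /middle.
case Ap: (A p); case Aq: (A q) => //=.
have py : p != y by apply: contraNneq nAy => <-.
have qx : q != x by apply: contraFneq Aq => ->.
rewrite py qx /=; case: (adj p q); last by rewrite !andbF.
case: eqVneq => [->|_] /=; first by rewrite adj_irr.
case: eqVneq => [->|_] /=; first by rewrite adj_irr !andbF.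
by case: (adj x p); case: (adj y q).
Qed.

Lemma crosses_ge : d <= paircount s (crosses A).
Proof.
have b_gt0 : 0 < beta.-1 by rewrite -subn1 subn_gt0.
by have [] := flow_slack _ _ _ _ _ _ _ _ _ _ b_gt0 flow_balance
  degree_split far_cross_split count_crosses.
Qed.

(** If no more than [d] edges leave [A], the flow leaves no slack: an edge
    leaving [A] that avoids [x] and [y] joins a neighbour of [x] to a
    neighbour of [y], and carries a full unit of flow, which needs [beta = 2].
    With both [xq] and [yp] adjacent, the edge from [q] to [p] would belong to
    [middle] and enter [A], a loss that the equality does not permit. *)
Lemma crosses_eq p q : paircount s (crosses A) <= d -> p \in s -> q \in s ->
    crosses A p q -> p != x -> q != y ->
  [/\ adj x p, adj y q, beta = 2 & ~~ (adj x q && adj y p)].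
Proof.
move=> le_d ps qs Apq px qy.
set fwd := paircount s (fun p q => [&& A p, ~~ A q & middle p q]).
set bwd := paircount s (fun p q => [&& ~~ A p, A q & middle p q]).
set rest := paircount s (fun p q => far_cross p q && ~~ (adj x p && adj y q)).
have far0 : paircount s far_cross <> 0.
  by move=> /paircount_eq0/(_ ps qs); rewrite /far_cross Apq px qy.
have [rest0 bwd0 beta2] : [/\ rest = 0, bwd = 0 & beta = 2].
  have b_gt0 : 0 < beta.-1 by rewrite -subn1 subn_gt0.
  have [_ /(_ le_d far0)[r0 b0 b1]] := flow_slack _ _ _ _ _ _ _ _ _ _ b_gt0
    flow_balance degree_split far_cross_split count_crosses.
  by split=> //; move: beta_gt1 b1; case: (beta) => [|[|[]]].
have /andP[xp yq] : adj x p && adj y q.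
  apply: contraT => n; have := paircount_eq0 p q rest0 ps qs.
  by rewrite /far_cross Apq px qy n.
split=> //; apply/negP => /andP[xq yp]; have := paircount_eq0 q p bwd0 qs ps.
have /and3P[Ap nAq pq] := Apq.
by rewrite nAq Ap /middle xq qy yp px adj_sym pq.
Qed.

End Cut.

(** * Edge sets whose removal disconnects the graph *)

Lemma crosses_set2_inj (A : pred G) p q p' q' :
    crosses A p q -> crosses A p' q' -> [set p; q] = [set p'; q'] ->
  (p, q) = (p', q').
Proof.
move=> /and3P[Ap nAq _] /and3P[Ap' nAq' _] E.
have : [set p'; q'] p by rewrite -E; left.
have : [set p'; q'] q by rewrite -E; right.
move=> [|] /= Eq [|] /= Ep; subst; rewrite ?Ap ?Ap' // in nAq nAq' *.
Qed.

(** A set with [k] members that contains all the edges leaving [A]: at most [k]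
    of these run inside [s], and if exactly [k] do, there are no other members. *)
Lemma crosses_le (A : pred G) (F : set (set G)) k s : uniq s -> F #= `I_k ->
    (forall p q, crosses A p q -> F [set p; q]) ->
  (paircount s (crosses A) <= k) /\
  (k <= paircount s (crosses A) ->
   forall e, F e -> exists p q, crosses A p q /\ e = [set p; q]).
Proof.
move=> s_uniq Fk AF.
apply: (@paircount_inj _ _ s_uniq (set G) _ (fun p q => [set p; q])) => //.
exact: crosses_set2_inj.
Qed.

Hypothesis G_conn : connected_graph G.

Lemma closed_full (P : G -> Prop) x : P x ->
  (forall p q, P p -> adj p q -> P q) -> forall v, P v.
Proof.
move=> Px Pstep v; have [l [+ <-]] := G_conn.2 x v.
by elim: l x Px => //= w l IH x Px /andP[xw]; apply: IH; apply: Pstep xw.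
Qed.

(** A component of the disconnected graph [G - F]: it is left by at least one
    edge of [G], and every such edge belongs to [F]. *)
Lemma disconnected_cut (F : set (set G)) : ~ connected_graph (del_edges F) ->
  exists A : pred G, (exists x y, crosses A x y) /\
    forall p q, crosses A p q -> F [set p; q].
Proof.
move=> ncon; have [x0 _] := G_conn.1.
have [u [v nuv]] : exists u v : G, ~ exists l, walk (G := del_edges F) u v l.
  apply: contrapT => H; apply: ncon; split; first by exists x0.
  move=> u v; apply: contrapT => nw; apply: H; by exists u, v.
exists (fun w => `[< exists l, walk (G := del_edges F) u w l >]); split.
  apply: contrapT => H; apply: nuv.
  apply: (closed_full (fun w => exists l, walk (G := del_edges F) u w l) u).
    by exists [::].
  move=> p q up pq; apply: contrapT => nuq; apply: H; exists p, q.
  by rewrite /crosses pq andbT; apply/andP; split; [exact/asboolP|apply/asboolP].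
move=> p q /and3P[/asboolP[l [ul lp]] /asboolP nuq pq].
apply: contrapT => nF; apply: nuq; exists (rcons l q).
split; last by rewrite last_rcons.
rewrite rcons_path ul lp /= /del_adj pq /=; exact/asboolP.
Qed.

(** * Cuts with [d] edges *)

Hypothesis beta_gt1 : 1 < beta.

Section DEdges.
Context (F : set (set G)) (A : pred G).
Hypothesis Fd : F #= `I_d.
Hypothesis AF : forall p q, crosses A p q -> F [set p; q].
Implicit Types (t : G).

Lemma disjoint_crosses x y p q : crosses A x y -> crosses A p q ->
    p != x -> q != y ->
  [/\ adj x p, adj y q, beta = 2 & ~~ (adj x q && adj y p)].
Proof.
move=> xy pq px qy; have [s [s_uniq sE]] := cover_exists [:: x; y; p; q].
have [_ sx] := sE x (mem_head _ _).
have [|_ sy] := sE y; first by rewrite !inE eqxx orbT.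
have [|ps _] := sE p; first by rewrite !inE eqxx !orbT.
have [|qs _] := sE q; first by rewrite !inE eqxx !orbT.
apply: (crosses_eq A s x y) => //.
by have [] := crosses_le A F d s s_uniq Fd AF.
Qed.

(** [F] has only [d] members, so none are left besides the edges leaving [A]. *)
Lemma cut_edge x y e : crosses A x y -> F e ->
  exists p q, crosses A p q /\ e = [set p; q].
Proof.
move=> xy; have [s [s_uniq sE]] := cover_exists [:: x; y].
have [_ sx] := sE x (mem_head _ _).
have [|_ sy] := sE y; first by rewrite !inE eqxx orbT.
have [_] := crosses_le A F d s s_uniq Fd AF; apply.
exact: (crosses_ge A s x y).
Qed.

(** Edges leaving [A] that pairwise meet form a star: triangles are excluded
    because the edges run between [A] and its complement. *)
Lemma crosses_star x y : crosses A x y ->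
    (forall p q p' q', crosses A p q -> crosses A p' q' -> p = p' \/ q = q') ->
  exists v, forall p q, crosses A p q -> p = v \/ q = v.
Proof.
move=> xy meet; apply: contrapT => nstar.
have [p [q [pq px]]] : exists p q, crosses A p q /\ p <> x.
  apply: contrapT => H; apply: nstar; exists x => p q pq; left.
  by apply: contrapT => px; apply: H; exists p, q.
have [p' [q' [pq' qy]]] : exists p q, crosses A p q /\ q <> y.
  apply: contrapT => H; apply: nstar; exists y => p' q' pq'; right.
  by apply: contrapT => qy; apply: H; exists p', q'.
have [//|Eq] := meet _ _ _ _ pq xy; have [Ep|//] := meet _ _ _ _ pq' xy.
by have [|] := meet _ _ _ _ pq pq'; congruence.
Qed.

Lemma star_edges_at x y v : F `<=` edges G -> crosses A x y ->
    (forall p q, crosses A p q -> p = v \/ q = v) ->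
  F = edges_at v.
Proof.
move=> FE xy star.
have Fv e : F e -> e v.
  by move=> /(cut_edge _ _ _ xy)[p [q [/star[->|->] ->]]]; [left|right].
have [s [s_uniq sE]] := cover_exists [:: v]; have [_ sv] := sE v (mem_head _ _).
pose l : seq (set G) := [seq [set v; w] | w <- filter (adj v) s].
have lE e : edges_at v e -> e \in l.
  move=> [[p [q [pq ->]]]] [|] /= Ev; rewrite -Ev in pq *.
    by apply: map_f; rewrite mem_filter pq sv.
  by rewrite setUC; apply: map_f; rewrite mem_filter adj_sym pq sv // adj_sym.
have Fl e : F e -> e \in l by move=> Fe; apply: lE; split; [exact: FE|exact: Fv].
apply/seteqP; split=> e; first by move=> Fe; split; [exact: FE|exact: Fv].
move/lE; have [_] := card_sub_seq _ F d l Fd Fl; apply.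
by rewrite size_map size_filter (count_adj s v).
Qed.

(** Two disjoint edges [xy] and [pq] leaving [A] lie on a quadrangle; if its
    diagonal [xq] is missing then [p] and [y] are the only common neighbours
    of [x] and [q], and no further edges leave [A] at [x] or [q]. *)
Lemma no_diagonal_unique x y p q : crosses A x y -> crosses A p q ->
    p != x -> q != y -> ~~ adj x q ->
  (forall t, crosses A x t -> t = y) /\ (forall t, crosses A t q -> t = p).
Proof.
move=> xy pq px qy nxq.
have [Ax nAy axy] := and3P xy; have [Ap nAq apq] := and3P pq.
have xq : x != q by apply: contraNneq nAq => <-.
have py : p != y by apply: contraNneq nAy => <-.
have [axp ayq beta2 _] := disjoint_crosses x y p q xy pq px qy.
split=> t.
  move=> xt; apply/eqP; apply: contraT => ty.
  have [_ nAt axt] := and3P xt.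
  have tq : t != q by apply: contraNneq nxq => <-.
  have pt : p != t by apply: contraNneq nAt => <-.
  rewrite eq_sym in px; have [_ aqt _ _] := disjoint_crosses p q x t pq xt px tq.
  suff : 3 <= beta by rewrite beta2.
  apply: (@common_le x q [:: p; y; t]) => //=.
    by rewrite !inE negb_or py pt eq_sym ty.
  move=> v; rewrite !inE => /or3P[] /eqP->; apply/andP; split=> //.
    by rewrite adj_sym.
  by rewrite adj_sym.
move=> tq; apply/eqP; apply: contraT => tp.
have [At _ atq] := and3P tq.
have tx : t != x by apply: contraNneq nxq => <-.
have yt : y != t by apply: contraNneq nAy => ->.
have [axt _ _ _] := disjoint_crosses x y t q xy tq tx qy.
suff : 3 <= beta by rewrite beta2.
apply: (@common_le x q [:: p; y; t]) => //=.
  by rewrite !inE negb_or py yt eq_sym tp.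
by move=> v; rewrite !inE => /or3P[] /eqP->; apply/andP; split; rewrite // adj_sym.
Qed.

(** A quadrangle on disjoint edges [xy] and [pq] leaving [A] has no diagonals.
    With a diagonal [py], every edge leaving [A] has [p] or [y] as an end and
    its other end adjacent to both, so [p] and [y] have at least [d - 1] common
    neighbours; but [p] and [x] have at most [d - 2], since [q] is not one. *)
Lemma disjoint_no_diagonal x y p q : crosses A x y -> crosses A p q ->
  p != x -> q != y -> ~~ adj p y.
Proof.
move=> xy pq px qy; apply/negP => apy.
have [Ax nAy axy] := and3P xy; have [Ap nAq apq] := and3P pq.
have py : crosses A p y by rewrite /crosses Ap nAy.
have [axp ayq beta2] := disjoint_crosses x y p q xy pq px qy.
rewrite [adj y p]adj_sym apy andbT => nxq.
have [ux uq] := no_diagonal_unique x y p q xy pq px qy nxq.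
have meet u t : crosses A u t -> u = p \/ t = y.
  move=> ut; apply: contrapT => /not_orP[u_p ty].
  have {}u_p : u != p by apply/eqP.
  have {}ty : t != y by apply/eqP.
  have u_x : u != x.
    apply: contra_not_neq (elimN eqP ty) => E.
    by apply: ux; rewrite -E.
  have tq : t != q.
    apply: contra_not_neq (elimN eqP u_p) => E.
    by apply: uq; rewrite -E.
  have [_ nAt _] := and3P ut.
  have nxt : ~~ adj x t.
    apply/negP => axt; move/eqP: ty; apply; apply: ux.
    by rewrite /crosses Ax nAt.
  have [_ tu] := no_diagonal_unique x y u t xy ut u_x ty nxt.
  have npt : ~~ adj p t.
    apply/negP => apt; move/eqP: u_p; apply; symmetry; apply: tu.
    by rewrite /crosses Ap nAt.
  have [up _] := no_diagonal_unique p q u t pq ut u_p tq npt.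
  by move/eqP: qy; apply; rewrite (up y).
have [s [s_uniq sE]] := cover_exists [:: x; y; p; q].
have [xs sx] := sE x (mem_head _ _).
have [|ys sy] := sE y; first by rewrite !inE eqxx orbT.
have [|ps sp] := sE p; first by rewrite !inE eqxx !orbT.
have [|qs sq] := sE q; first by rewrite !inE eqxx !orbT.
have many : d <= alpha.+1.
  apply: leq_trans (crosses_ge A s p y s_uniq sp sy py beta_gt1) _.
  rewrite (count_crosses A s p y s_uniq sp sy py).
  have -> : paircount s (far_cross A p y) = 0.
    apply: big1 => u _; apply: big1 => v _; rewrite /far_cross.
    case uv: (crosses A u v) => //=.
    by have [->|->] := meet u v uv; rewrite eqxx ?andbF.
  rewrite addn0 -(count_common_adj s p y s_uniq sy apy).
  rewrite (@count_remove _ s s_uniq _ y ys) ?apy // addSn ltnS.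
  rewrite (@countD _ s (fun v => adj p v && adj y v)
    (fun v => [&& adj p v, adj y v & ~~ A v])
    (fun v => [&& adj p v, adj y v & A v])).
    apply: leq_add; apply: sub_count => v /=.
      move=> /andP[/andP[apv nAv] vy].
      have pv : crosses A p v by rewrite /crosses Ap nAv.
      rewrite apv nAv andbT.
      by have [_ ->] := disjoint_crosses x y p v xy pv px vy.
    move=> /and3P[Av ayv vp].
    have vy : crosses A v y by rewrite /crosses Av nAy adj_sym.
    rewrite eq_sym in qy; rewrite ayv Av andbT.
    by have [->] := disjoint_crosses p q v y pq vy vp qy.
  by move=> v; case: (adj p v); case: (adj y v); case: (A v).
have few : alpha.+2 <= d.
  rewrite adj_sym in axp.
  rewrite -(count_adj s p s_uniq sp) -(count_common_adj s p x s_uniq sx axp).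
  rewrite (@count_remove _ s s_uniq (adj p) x xs axp) ltnS.
  rewrite (@count_remove _ s s_uniq _ q qs) /=; last first.
    by rewrite apq; apply: contraNneq nAq => ->.
  rewrite ltnS; apply: sub_count => v /= /andP[-> axv] /=; apply/andP; split.
    by rewrite eq_sym adj_neq.
  by apply: contraNneq nxq => <-.
by have := leq_trans few many; rewrite ltnn.
Qed.

(** If two disjoint edges leave [A], the graph is the quadrangle on them. *)
Lemma disjoint_quadrangle x y p q :
  crosses A x y -> crosses A p q -> p != x -> q != y -> quadrangle G.
Proof.
move=> xy pq px qy.
have xp : x != p by rewrite eq_sym.
have yq : y != q by rewrite eq_sym.
have npy := disjoint_no_diagonal x y p q xy pq px qy.
have nxq := disjoint_no_diagonal p q x y pq xy xp yq.
have [Ax nAy axy] := and3P xy; have [Ap nAq apq] := and3P pq.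
have [axp ayq _ _] := disjoint_crosses x y p q xy pq px qy.
have [ux uq] := no_diagonal_unique x y p q xy pq px qy nxq.
have [up uy] := no_diagonal_unique p q x y pq xy xp yq npy.
have [s [s_uniq sE]] := cover_exists [:: x; y; p; q].
have [xs sx] := sE x (mem_head _ _).
have [|ys sy] := sE y; first by rewrite !inE eqxx orbT.
have [|ps sp] := sE p; first by rewrite !inE eqxx !orbT.
have alpha0 : alpha = 0.
  rewrite -(count_common_adj s x y s_uniq sy axy).
  apply/eqP; rewrite -leqn0 leqNgt -has_count; apply/hasPn => z _.
  apply/negP => /andP[axz ayz]; case Az: (A z).
    have zx : z = x by apply: uy; rewrite /crosses Az nAy adj_sym.
    by rewrite zx adj_irr in axz.
  have zy : z = y by apply: ux; rewrite /crosses Az Ax.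
  by rewrite zy adj_irr in ayz.
have only u v : crosses A u v -> [set u; v] \in [:: [set x; y]; [set p; q]].
  move=> uv; rewrite !inE.
  have [ux'|ux'] := eqVneq u x.
    by move: uv; rewrite ux' => /ux ->; rewrite eqxx.
  have [up'|up'] := eqVneq u p.
    by move: uv; rewrite up' => /up ->; rewrite eqxx orbT.
  have vy : v != y by apply: contraNneq ux' => E; apply/eqP/uy; rewrite -E.
  have vq : v != q by apply: contraNneq up' => E; apply/eqP/uq; rewrite -E.
  have [axu _ _ _] := disjoint_crosses x y u v xy uv ux' vy.
  have [apu _ _ _] := disjoint_crosses p q u v pq uv up' vq.
  have := count_common_adj s x p s_uniq sp axp.
  rewrite alpha0 => /eqP; rewrite -leqn0 leqNgt -has_count => /hasPn/(_ u).
  by rewrite axu apu sx // => /(_ isT).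
have d2 : d <= 2.
  have FE2 e : F e -> e \in [:: [set x; y]; [set p; q]].
    by move=> /(cut_edge _ _ _ xy)[u [v [/only + ->]]].
  by have [] := card_sub_seq _ F d _ Fd FE2.
have x_y : x != y by rewrite adj_neq.
have x_q : x != q by apply: contraNneq nAq => <-.
have p_y : p != y by apply: contraNneq nAy => <-.
have p_q : p != q by rewrite adj_neq.
have y_p : y != p by rewrite eq_sym.
have ayx : adj y x by rewrite adj_sym.
have apx : adj p x by rewrite adj_sym.
have aqy : adj q y by rewrite adj_sym.
have aqp : adj q p by rewrite adj_sym.
(* The vertices in cyclic order. *)
pose l := [:: x; y; q; p].
have l_uniq : uniq l.
  rewrite /l !cons_uniq !inE (negbTE x_y) (negbTE x_q) (negbTE xp) (negbTE yq).
  by rewrite (negbTE y_p) [q == p]eq_sym (negbTE p_q).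
have nbr u v w z : u != v -> adj w u -> adj w v -> adj w z -> z = u \/ z = v.
  move=> uv wu wv wz; have : z \in [:: u; v].
    apply: adj_mem wz => //; first by rewrite !cons_uniq !inE uv.
    by move=> t; rewrite !inE => /orP[] /eqP->.
  by rewrite !inE => /orP[] /eqP->; [left|right].
have lP v : v \in l.
  move: v; apply: (closed_full (fun v => v \in l) x); first exact: mem_head.
  move=> u v; rewrite !inE => /or4P[] /eqP-> uv.
  - by have [//|//|//|//|->|->] := nbr y p x v; rewrite eqxx ?orbT.
  - by have [//|//|//|//|->|->] := nbr x q y v; rewrite eqxx ?orbT.
  - by have [//|//|//|//|->|->] := nbr y p q v; rewrite eqxx ?orbT.
  - by have [//|//|//|//|->|->] := nbr x q p v; rewrite eqxx ?orbT.
have lt4 v : index v l < 4 by rewrite -[4]/(size l) index_mem.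
exists (fun v => Ordinal (lt4 v) : cycle_graph 4).
  exists (fun i : cycle_graph 4 => nth x l i) => [v|i] /=.
    by rewrite nth_index.
  by apply: val_inj; apply: index_uniq l_uniq; exact: (ltn_ord i).
move=> u v.
have -> : adj (Ordinal (lt4 u) : cycle_graph 4) (Ordinal (lt4 v)) =
    (index u l != index v l) && ((index v l == (index u l).+1 %% 4) ||
                                 (index u l == (index v l).+1 %% 4)) by [].
have idx i : i < 4 -> index (nth x l i) l = i by move=> i4; exact: index_uniq.
have ix : index x l = 0 := idx 0 isT.
have iy : index y l = 1 := idx 1 isT.
have iq : index q l = 2 := idx 2 isT.
have ip : index p l = 3 := idx 3 isT.
have nyp : ~~ adj y p by rewrite adj_sym.
have nqx : ~~ adj q x by rewrite adj_sym.
have := lP u; have := lP v; rewrite !inE.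
case/or4P=> /eqP-> /or4P[] /eqP->; rewrite ?(ix, iy, iq, ip) ?adj_irr //; symmetry;
  by [|apply: negbTE].
Qed.


End DEdges.
End Regularity.

Theorem theorem1p4 (G : sgraph) (d alpha beta : nat)
    (G_locfin : locally_finite G)
    (G_conn : connected_graph G)
    (G_amply : amply_regular G d alpha beta)
    (beta_gt1 : 1 < beta) :
  edge_connected G d /\
  (~ quadrangle G ->
   forall F : set (set G),
     F #= `I_d -> disconnecting F -> exists v : G, F = edges_at v).
Proof.
split.
  split.
    have [_ _ nempty _ _] := G_amply; apply: contrapT => H; apply: nempty => x y.
    apply/negP => xy; apply: H; exists x, y => E; by rewrite E adj_irr in xy.
  move=> F _ [k kd Fk]; apply: contrapT.
  move=> /(disconnected_cut G_conn)[A [[x [y xy]] AF]].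
  have [s [s_uniq sE]] := cover_exists d alpha beta G_amply [:: x; y].
  have [_ sx] := sE x (mem_head _ _).
  have [|_ sy] := sE y; first by rewrite !inE eqxx orbT.
  have [le_k _] := crosses_le A F k s s_uniq Fk AF.
  have := leq_trans (crosses_ge d alpha beta G_amply A s x y
    s_uniq sx sy xy beta_gt1) le_k.
  by rewrite leqNgt kd.
move=> nquad F Fd [FE /(disconnected_cut G_conn)[A [[x [y xy]] AF]]].
have [p q p' q' pq pq'|v star] := crosses_star A x y xy.
  apply: contrapT => /not_orP[pp qq]; apply: nquad.
  apply: (disjoint_quadrangle d alpha beta G_amply G_conn beta_gt1 F A Fd AF
    p q p' q') => //.
    by apply/eqP => E; apply: pp.
  by apply/eqP => E; apply: qq.
exists v; exact: (star_edges_at d alpha beta G_amply beta_gt1 F A Fd AF x y).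
Qed.
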